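(* Let $p$ be an odd prime, $q=p^n$ with $n\in\mathbb N$, and let $\mathbb P^2=\{(\boldsymbol\xi,\tau)\in\mathbb F_q^2\times\mathbb F_q:\tau=\boldsymbol\xi\cdot\boldsymbol\xi\}\subset\mathbb F_q^3$ be equipped with its normalized surface measure $\sigma$. Then $$\mathbf R^*_{\mathbb P^2}(2\to4)=(1+q^{-1}-q^{-2})^{1/4}.$$ In other words, the inequality $$\|(f\sigma)^\vee\|_{L^4(\mathbb F_q^3,\mathrm d\boldsymbol x)}^4\le\left(1+\frac1q-\frac1{q^2}\right)\|f\|_{L^2(\mathbb P^2,\mathrm d\sigma)}^4$$ holds for all $f:\mathbb P^2\to\mathbb C$ and is sharp (the constant is best possible), and equality holds if $f:\mathbb P^2\to\mathbb C$ is a constant function. Moreover, any maximizer $f$ of this inequality has constant modulus, i.e. $|f|$ is constant on $\mathbb P^2$.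
   Context: $\mathbb F_q$ is the finite field with $q$ elements and $e:\mathbb F_q\to\mathbb S^1\subset\mathbb C$ is a fixed nontrivial additive character. For $\boldsymbol x,\boldsymbol\xi\in\mathbb F_q^d$, $\boldsymbol x\cdot\boldsymbol\xi=\sum_i x_i\xi_i$. For a nonempty set $S\subset\mathbb F_q^d$ (frequency space $\mathbb F_q^{d*}$ is identified with $\mathbb F_q^d$) with normalized surface measure $\sigma$ (uniform probability measure on $S$) and $f:S\to\mathbb C$, the extension operator is $$(f\sigma)^\vee(\boldsymbol x)=\frac1{|S|}\sum_{\boldsymbol\xi\in S}f(\boldsymbol\xi)e(\boldsymbol x\cdot\boldsymbol\xi),\quad \boldsymbol x\in\mathbb F_q^d.$$ Norms: $\|f\|_{L^r(S,\mathrm d\sigma)}=\big(\frac1{|S|}\sum_{\boldsymbol\xi\in S}|f(\boldsymbol\xi)|^r\big)^{1/r}$ and $\|g\|_{L^r(\mathbb F_q^d,\mathrm d\boldsymbol x)}=\big(\sum_{\boldsymbol x\in\mathbb F_q^d}|g(\boldsymbol x)|^r\big)^{1/r}$ (counting measure). $\mathbf R^*_S(r\to s)$ denotes the best (smallest) constant for which $\|(f\sigma)^\vee\|_{L^s(\mathbb F_q^d,\mathrm d\boldsymbol x)}\le\mathbf R^*_S(r\to s)\|f\|_{L^r(S,\mathrm d\sigma)}$ holds for all $f:S\to\mathbb C$. A maximizer is a not identically zero function $f:S\to\mathbb C$ for which equality holds in the inequality with best constant. *)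

(* Defs.v *)
From HB Require Import structures.
From mathcomp Require Import all_boot all_order all_algebra.
From mathcomp Require Import classical_sets reals exp complex.

Set Implicit Arguments.
Unset Strict Implicit.
Unset Printing Implicit Defensive.
Import Order.TTheory GRing.Theory Num.Theory.
Local Open Scope ring_scope.

(* The field of complex numbers is [R[i]] with [R : realType]; the modulus of
   a complex number, as an element of [R], is [ComplexField.Normc.normc]. *)

Definition dotv (F : finFieldType) (d : nat) (x y : 'rV[F]_d) : F :=
  \sum_(i < d) x 0 i * y 0 i.

Definition nontrivial_additive_character (R : realType) (F : finFieldType)
    (e : F -> R[i]) : Prop :=
  [/\ forall x, ComplexField.Normc.normc (e x) = 1,
      forall x y, e (x + y) = e x * e y
    & exists x, e x <> 1].

(* Functions on [S] are functions on the subtype [{xi | xi \in S}], so that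
   they carry no values outside [S]. *)
Definition extension (R : realType) (F : finFieldType) (d : nat)
    (e : F -> R[i]) (S : {set 'rV[F]_d}) (f : {xi | xi \in S} -> R[i])
    (x : 'rV[F]_d) : R[i] :=
  (#|S|%:R)^-1 * \sum_(xi : {xi | xi \in S}) f xi * e (dotv x (val xi)).

(* L^r norm with respect to the uniform probability measure on [S]. *)
Definition surface_norm (R : realType) (F : finFieldType) (d : nat)
    (S : {set 'rV[F]_d}) (r : R) (f : {xi | xi \in S} -> R[i]) : R :=
  ((#|S|%:R)^-1 *
     \sum_(xi : {xi | xi \in S}) ComplexField.Normc.normc (f xi) `^ r) `^ r^-1.

(* L^r norm with respect to the counting measure. *)
Definition counting_norm (R : realType) (F : finFieldType) (d : nat)
    (r : R) (g : 'rV[F]_d -> R[i]) : R :=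
  (\sum_(x : 'rV[F]_d) ComplexField.Normc.normc (g x) `^ r) `^ r^-1.

(* [extension_bound e S r s C]: the L^r(S, sigma) -> L^s(F^d, dx) extension
   inequality holds with constant [C]. *)
Definition extension_bound (R : realType) (F : finFieldType) (d : nat)
    (e : F -> R[i]) (S : {set 'rV[F]_d}) (r s C : R) : Prop :=
  forall f : {xi | xi \in S} -> R[i],
    counting_norm s (extension e f) <= C * surface_norm r f.

(* R*_S(r -> s); meaningful for nonempty [S], where the set of admissible
   constants is bounded below by 0. *)
Definition best_extension_constant (R : realType) (F : finFieldType) (d : nat)
    (e : F -> R[i]) (S : {set 'rV[F]_d}) (r s : R) : R :=
  inf [set C : R | extension_bound e S r s C]%classic.

Definition is_maximizer (R : realType) (F : finFieldType) (d : nat)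
    (e : F -> R[i]) (S : {set 'rV[F]_d}) (r s : R)
    (f : {xi | xi \in S} -> R[i]) : Prop :=
  (exists xi, f xi <> 0) /\
  counting_norm s (extension e f) =
    best_extension_constant e S r s * surface_norm r f.

(* The points (xi, tau) of F^d x F, viewed as row vectors of length d + 1,
   with tau = xi . xi. *)
Definition paraboloid (F : finFieldType) (d : nat) : {set 'rV[F]_(d + 1)} :=
  [set x : 'rV[F]_(d + 1) |
     (rsubmx x : 'rV[F]_1) 0 0 ==
       dotv (lsubmx x : 'rV[F]_d) (lsubmx x : 'rV[F]_d)].

(* Main.v *)
Require Import Defs.
From HB Require Import structures.
From mathcomp Require Import all_boot all_order all_algebra.
From mathcomp Require Import ring lra.
From mathcomp Require Import classical_sets reals exp complex.

(** Parametrize the paraboloid by F^2 and write a pair of points as c + t and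
    c - t.
    The square of the extension of f is then the Fourier transform of
    (c, r) |-> G(c, r), the sum of f (c + t) f (c - t) over the circle
    t . t = r, so by Parseval the fourth power of its L^4 norm is
    q^-5 sum_{c, r} |G(c, r)|^2. With M the sum of |f|^2, this sum is at most
    (q + 1) M^2 - q sum |f|^4, and M^2 <= q^2 sum |f|^4 by Cauchy-Schwarz, with
    equality only if |f| is constant.

    Cauchy-Schwarz on every circle gives the bound when -1 is not a square: the
    circles of nonzero radius have q + 1 points and the null circle has only
    one. When -1 is a square, t . t is u v in suitable coordinates, the circles
    of nonzero radius have q - 1 points, and the null circle is the union of two
    lines. If A and B are the sums along these lines without t = 0, and C is the
    term t = 0, then (A + B + C)^2 = A^2 + B^2 + 2 (A + C) (B + C) - C^2;
    Cauchy-Schwarz applies to A and B, while A + C and B + C are at most the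
    sums of |f|^2 over the two null lines through c, whose product adds up to
    M^2 over all c. *)

Set Implicit Arguments.
Unset Strict Implicit.
Unset Printing Implicit Defensive.
Import Order.TTheory GRing.Theory Num.Theory.
Local Open Scope ring_scope.

Local Notation normc := ComplexField.Normc.normc.

(** * Cauchy-Schwarz and its equality case *)

Lemma sum_sqr_deviation (R : comPzRingType) (I : finType) (P : pred I)
    (h : I -> R) (N := #|P|%:R : R) (S := \sum_(i | P i) h i) :
  \sum_(i | P i) (N * h i - S) ^+ 2 =
    N * (N * \sum_(i | P i) h i ^+ 2 - S ^+ 2).
Proof.
transitivity (\sum_(i | P i)
    (N ^+ 2 * h i ^+ 2 + (- (N * S) *+ 2) * h i + S ^+ 2)).
  by apply: eq_bigr => i _; ring.
rewrite !big_split /= sumr_const -!mulr_sumr -/S -mulr_natr -/N.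
by ring.
Qed.

Lemma sqr_sum_le (R : realFieldType) (I : finType) (P : pred I) (h : I -> R) :
  (\sum_(i | P i) h i) ^+ 2 <= #|P|%:R * \sum_(i | P i) h i ^+ 2.
Proof.
have [N0|N0] := posnP #|P|.
  by rewrite big_pred0 ?N0 ?mul0r ?expr0n // => i; apply: (card0_eq N0).
rewrite -subr_ge0 -(@pmulr_rge0 _ #|P|%:R) ?ltr0n // -sum_sqr_deviation.
by apply: sumr_ge0 => i _; apply: sqr_ge0.
Qed.

(** The hypothesis makes the sum of squares in [sum_sqr_deviation] nonpositive, so every deviation
    from the mean vanishes. *)
Lemma sqr_sum_ge_const (R : realFieldType) (I : finType) (h : I -> R) :
    #|I|%:R * \sum_i h i ^+ 2 <= (\sum_i h i) ^+ 2 ->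
  forall i, h i = (\sum_i h i) / #|I|%:R.
Proof.
move=> le_h i.
have N0 : (#|I|%:R : R) != 0.
  by rewrite pnatr_eq0 -lt0n; apply/card_gt0P; exists i.
have: \sum_i (#|I|%:R * h i - \sum_i h i) ^+ 2 = 0.
  apply/eqP; rewrite eq_le sumr_ge0 => [|j _]; last exact: sqr_ge0.
  by rewrite andbT sum_sqr_deviation mulr_ge0_le0 ?subr_le0.
move/psumr_eq0P => /(_ (fun j _ => sqr_ge0 _)) /(_ i isT) /eqP.
by rewrite sqrf_eq0 subr_eq0 => /eqP <-; rewrite mulrC mulKf.
Qed.

(** * Pairs of points in midpoint coordinates *)

Lemma addrr_inj (F : finFieldType) : (2 : F) != 0 ->
  injective (fun x : F * F => x + x).
Proof.
move=> F2 [x1 x2] [y1 y2] [e1 e2].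
have half (x y : F) : x + x = y + y -> x = y.
  by move=> exy; apply: (mulfI F2); rewrite !mulr_natl !mulr2n.
by rewrite (half _ _ e1) (half _ _ e2).
Qed.

(** Since 2 is invertible, [(c, t)] to [(c + t, c - t)] is injective on a finite set, hence a change
    of variables for pairs of points. *)
Lemma sum_midpoint (F : finFieldType) (K : pzRingType) (g h : F * F -> K) :
    (2 : F) != 0 ->
  \sum_(c : F * F) \sum_(t : F * F) g (c + t) * h (c - t) =
    (\sum_x g x) * (\sum_y h y).
Proof.
move=> F2; rewrite big_distrlr /= !pair_big /=.
pose V := (F * F)%type.
have inj : injective (fun u : V * V => (u.1 + u.2, u.1 - u.2)).
  move=> u v e.
  have e1 : u.1 + u.2 = v.1 + v.2 := congr1 fst e.
  have e2 : u.1 - u.2 = v.1 - v.2 := congr1 snd e.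
  have dbl (x y : V) : x + x = (x + y) + (x - y) by rewrite addrACA subrr addr0.
  have ec : u.1 = v.1.
    by apply: (addrr_inj F2); rewrite (dbl u.1 u.2) e1 e2 -dbl.
  by move: e1; rewrite ec => /addrI et; apply/eqP/andP; rewrite ec et.
by rewrite [RHS](reindex_inj inj).
Qed.

(** * Circle sums, the energy and its upper bounds *)

Definition circle_sum (F : finFieldType) (K : pzRingType) (Q : F * F -> F)
    (a : F * F -> K) (c : F * F) (r : F) : K :=
  \sum_(t | Q t == r) a (c + t) * a (c - t).

(** For [Q] the sum of two squares this is the weighted additive energy of the paraboloid: the sum
    of the points above [c + t] and [c - t] depends exactly on [c] and [Q t]. *)
Definition energy (F : finFieldType) (K : pzRingType) (Q : F * F -> F)
    (a : F * F -> K) : K :=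
  \sum_c \sum_r circle_sum Q a c r ^+ 2.

Definition sqnorm (F : finFieldType) (t : F * F) : F := t.1 ^+ 2 + t.2 ^+ 2.

(** Cauchy-Schwarz costs a factor [N] on each circle of nonzero radius. By [sum_midpoint] applied to
    the squares of [a], all circles together contribute the square of the sum of [a x ^+ 2]; the
    null circle is subtracted from it and kept for separate treatment. *)
Lemma energy_le_circles (R : realFieldType) (F : finFieldType)
    (Q : F * F -> F) (a : F * F -> R) (N : R) :
    (2 : F) != 0 -> (forall r, r != 0 -> #|[pred t | Q t == r]|%:R = N) ->
  energy Q a <=
    N * ((\sum_x a x ^+ 2) ^+ 2 -
         \sum_c circle_sum Q (fun x => a x ^+ 2) c 0) +
    \sum_c circle_sum Q a c 0 ^+ 2.
Proof.
move=> F2 cardQ; rewrite expr2 -(sum_midpoint _ _ F2).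
rewrite -sumrB mulr_sumr -big_split /=; apply: ler_sum => c _.
pose g x := a x ^+ 2.
have -> : \sum_t g (c + t) * g (c - t) - circle_sum Q g c 0 =
    \sum_(r | r != 0) circle_sum Q g c r.
  by rewrite (partition_big Q predT) // (bigD1 0) //= addrAC subrr add0r.
rewrite (bigD1 0) //= addrC lerD2r mulr_sumr.
apply: ler_sum => r r0; rewrite -(cardQ r r0) /circle_sum.
apply: le_trans (sqr_sum_le _ _) _.
by under eq_bigr do rewrite exprMn.
Qed.

(** The null circle is the single point 0, so both null terms of [energy_le_circles] reduce to the
    sum of [a x ^+ 4]. *)
Lemma energy_anisotropic_le (R : realFieldType) (F : finFieldType)
    (Q : F * F -> F) (a : F * F -> R) (q := #|F|%:R : R) :
    (2 : F) != 0 -> (forall t, (Q t == 0) = (t == 0)) ->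
    (forall r, r != 0 -> #|[pred t | Q t == r]|%:R = q + 1) ->
  energy Q a <= (q + 1) * (\sum_x a x ^+ 2) ^+ 2 - q * \sum_x a x ^+ 4.
Proof.
move=> F2 Q0 cardQ; apply: le_trans (energy_le_circles a F2 cardQ) _.
have cs0 (b : F * F -> R) c : circle_sum Q b c 0 = b c ^+ 2.
  by rewrite /circle_sum (eq_bigl _ _ Q0) big_pred1_eq addr0 subr0.
rewrite [X in _ * (_ - X)](eq_bigr (fun c => a c ^+ 4)) => [|c _];
  last by rewrite cs0 -exprM.
rewrite [X in _ + X](eq_bigr (fun c => a c ^+ 4)) => [|c _].
  by rewrite le_eqVlt; apply/orP; left; apply/eqP; ring.
by rewrite cs0 -exprM.
Qed.

Lemma sum_axes (F : finFieldType) (K : nmodType) (h : F * F -> K) :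
  \sum_(t | t.1 * t.2 == 0) h t =
    \sum_(s | s != 0) h (s, 0) + \sum_(s | s != 0) h (0, s) + h (0, 0).
Proof.
rewrite (eq_bigr (fun t => h (t.1, t.2))) => [|[]//].
rewrite -(pair_big_dep predT (fun u v => u * v == 0) (fun u v => h (u, v))) /=.
rewrite (bigD1 0) //= (eq_bigl predT) => [|v]; last by rewrite mul0r eqxx.
rewrite (bigD1 0) //= addrC -[RHS]addrA [X in _ = _ + X]addrC; congr (_ + _).
apply: eq_bigr => u u0; rewrite (big_pred1 0) // => v.
by rewrite mulf_eq0 (negPf u0).
Qed.

(** Since 2xy is at most x^2 + y^2, and [u + s] and [u - s] both run over all of [V], each of the
    two sums of squares is the right-hand side. *)
Lemma sum_reflection_le (R : realFieldType) (V : finZmodType) (h : V -> R) u :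
  \sum_s h (u + s) * h (u - s) <= \sum_x h x ^+ 2.
Proof.
have addE : \sum_s h (u + s) ^+ 2 = \sum_x h x ^+ 2.
  by rewrite [RHS](reindex_inj (addrI u)).
have subE : \sum_s h (u - s) ^+ 2 = \sum_x h x ^+ 2.
  by rewrite [RHS](reindex_inj (inj_comp (addrI u) oppr_inj)).
have : 0 <= \sum_s (h (u + s) - h (u - s)) ^+ 2.
  by apply: sumr_ge0 => s _; apply: sqr_ge0.
have -> : \sum_s (h (u + s) - h (u - s)) ^+ 2 =
    \sum_s h (u + s) ^+ 2 + \sum_s h (u - s) ^+ 2
    - (\sum_s h (u + s) * h (u - s)) *+ 2.
  rewrite -sumrMnl -big_split -sumrB /=; apply: eq_bigr => s _; ring.
rewrite addE subE; lra.
Qed.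

Lemma card_nonzero (R : pzRingType) (F : finFieldType) :
  #|[pred s : F | s != 0]|%:R = #|F|%:R - 1 :> R.
Proof.
have := cardC (pred1 (0 : F)); rewrite card1 => <-.
by rewrite natrD addrAC subrr add0r.
Qed.

Lemma energy_hyperbolic_le (R : realFieldType) (F : finFieldType)
    (Q := fun t : F * F => t.1 * t.2) (a : F * F -> R) (q := #|F|%:R : R) :
    (2 : F) != 0 -> (forall x, 0 <= a x) ->
    (forall r, r != 0 -> #|[pred t | Q t == r]|%:R = q - 1) ->
  energy Q a <= (q + 1) * (\sum_x a x ^+ 2) ^+ 2 - q * \sum_x a x ^+ 4.
Proof.
move=> F2 a0 cardQ; apply: le_trans (energy_le_circles a F2 cardQ) _.
pose g x := a x ^+ 2.
pose hor (b : F * F -> R) (c : F * F) :=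
  \sum_(s | s != 0) b (c.1 + s, c.2) * b (c.1 - s, c.2).
pose ver (b : F * F -> R) (c : F * F) :=
  \sum_(s | s != 0) b (c.1, c.2 + s) * b (c.1, c.2 - s).
have cs0 b c : circle_sum Q b c 0 = hor b c + ver b c + b c ^+ 2.
  rewrite /circle_sum sum_axes addr0 subr0 -expr2; congr (_ + _ + _).
    by apply: eq_bigr => s _; case: c => u v; congr (b _ * b _); congr pair;
       rewrite /= ?addr0 ?subr0.
  by apply: eq_bigr => s _; case: c => u v; congr (b _ * b _); congr pair;
     rewrite /= ?addr0 ?subr0.
have hor0 c : 0 <= hor a c by apply: sumr_ge0 => s _; apply: mulr_ge0.
have ver0 c : 0 <= ver a c by apply: sumr_ge0 => s _; apply: mulr_ge0.
have hor2 c : hor a c ^+ 2 <= (q - 1) * hor g c.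
  rewrite -card_nonzero; apply: le_trans (sqr_sum_le _ _) _.
  by under eq_bigr do rewrite exprMn.
have ver2 c : ver a c ^+ 2 <= (q - 1) * ver g c.
  rewrite -card_nonzero; apply: le_trans (sqr_sum_le _ _) _.
  by under eq_bigr do rewrite exprMn.
pose row v := \sum_u g (u, v).
pose col u := \sum_v g (u, v).
have hor_row c : hor a c + a c ^+ 2 <= row c.2.
  apply: le_trans (sum_reflection_le (fun x => a (x, c.2)) c.1).
  rewrite [X in _ <= X](bigD1 0) //= addr0 subr0 -expr2 addrC.
  by rewrite -surjective_pairing.
have ver_col c : ver a c + a c ^+ 2 <= col c.1.
  apply: le_trans (sum_reflection_le (fun y => a (c.1, y)) c.2).
  rewrite [X in _ <= X](bigD1 0) //= addr0 subr0 -expr2 addrC.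
  by rewrite -surjective_pairing.
(* A row and a column meet in exactly one point [c], so the sum over [c] factors into all rows times
   all columns. *)
have row_col : \sum_c row c.2 * col c.1 = (\sum_x g x) ^+ 2.
  rewrite -(pair_bigA _ (fun u v => row v * col u)) /=.
  rewrite exchange_big -big_distrlr /=.
  rewrite expr2; congr (_ * _); last first.
    by rewrite pair_bigA; apply: eq_bigr => -[].
  by rewrite exchange_big pair_bigA; apply: eq_bigr => -[].
have pt c : circle_sum Q a c 0 ^+ 2 <=
    (q - 1) * hor g c + (q - 1) * ver g c + 2 * (row c.2 * col c.1) - a c ^+ 4.
  rewrite cs0.
  have -> : (hor a c + ver a c + a c ^+ 2) ^+ 2 = hor a c ^+ 2 + ver a c ^+ 2 +
      2 * ((hor a c + a c ^+ 2) * (ver a c + a c ^+ 2)) - a c ^+ 4 by ring.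
  have := ler_pM (addr_ge0 (hor0 c) (sqr_ge0 (a c)))
    (addr_ge0 (ver0 c) (sqr_ge0 (a c))) (hor_row c) (ver_col c).
  have := hor2 c; have := ver2 c; lra.
apply: le_trans (lerD (lexx _) (ler_sum _ (fun c _ => pt c))) _.
rewrite sumrB !big_split /= -!mulr_sumr row_col.
have -> : \sum_c circle_sum Q g c 0 =
    \sum_c hor g c + \sum_c ver g c + \sum_c a c ^+ 4.
  by rewrite -!big_split /=; apply: eq_bigr => c _; rewrite cs0 -exprM.
(* The sums of [hor g] and [ver g] cancel; what remains is [q - 1] plus 2 copies of the squared
   mass, minus [q - 1] plus 1 copies of the fourth-power sum. *)
by rewrite -/g le_eqVlt; apply/orP; left; apply/eqP; ring.
Qed.

(** Invariance under additive changes of coordinates, which carries the bound for u v over to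
    [sqnorm]. *)
Lemma energy_comp (F : finFieldType) (K : pzRingType) (Q : F * F -> F)
    (a : F * F -> K) (L : F * F -> F * F) :
    injective L -> {morph L : x y / x + y} ->
  energy (Q \o L) (a \o L) = energy Q a.
Proof.
move=> injL LD.
have LB x y : L (x - y) = L x - L y.
  by apply/eqP; rewrite eq_sym subr_eq -LD subrK.
rewrite /energy [RHS](reindex_inj injL); apply: eq_bigr => c _.
apply: eq_bigr => r _; congr (_ ^+ 2).
rewrite /circle_sum [RHS](reindex_inj injL).
by apply: eq_bigr => t _; rewrite -LD -LB.
Qed.

(** * Counting points on circles *)

Lemma sum_card_fibres (T I : finType) (Q : T -> I) :
  (\sum_r #|[pred t | Q t == r]| = #|T|)%N.
Proof.
rewrite -sum1_card (partition_big Q predT) //=.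
by apply: eq_bigr => r _; rewrite sum1_card.
Qed.

(** The circles partition the plane; this yields the size of the null circle from [N], or [N] from
    the size of the null circle. *)
Lemma sum_card_circles (R : pzRingType) (F : finFieldType)
    (Q : F * F -> F) (N : R) (q := #|F|%:R : R) :
    (forall r, r != 0 -> #|[pred t | Q t == r]|%:R = N) ->
  #|[pred t | Q t == 0]|%:R + (q - 1) * N = q ^+ 2.
Proof.
move=> cardQ; rewrite expr2 -natrM -card_prod -(sum_card_fibres Q) natr_sum.
rewrite (bigD1 0) //=; congr (_ + _).
by rewrite (eq_bigr _ cardQ) sumr_const -mulr_natl card_nonzero.
Qed.

(** The null circle has 2q - 1 points when N = q - 1 and one point when N = q + 1; both cases give
    the same sum, so the sharp constant does not depend on whether -1 is a square. *)
Lemma sum_sqr_card_circles (R : comPzRingType) (F : finFieldType)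
    (Q : F * F -> F) (N : R) (q := #|F|%:R : R) :
    (forall r, r != 0 -> #|[pred t | Q t == r]|%:R = N) ->
    N = q - 1 \/ N = q + 1 ->
  \sum_r #|[pred t | Q t == r]|%:R ^+ 2 = q ^+ 3 + q ^+ 2 - q.
Proof.
move=> cardQ hN; rewrite (bigD1 0) //=.
rewrite (eq_bigr (fun=> N ^+ 2)) => [|r r0]; last by rewrite cardQ.
rewrite sumr_const -[N ^+ 2 *+ _]mulr_natl card_nonzero -/q.
have /(canRL (addrK _)) -> := sum_card_circles cardQ; rewrite -/q.
by case: hN => ->; ring.
Qed.

(** A nonzero square has at most two roots and 0 has only one. Adding 1 at [y == 0] to the root
    count still leaves at most 2 per square, whence q + 1 is at most twice the number of squares. *)
Lemma card_squares_gt (F : finFieldType) :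
  (#|F| < 2 * #|[set x ^+ 2 | x : F]|)%N.
Proof.
set S := [set x ^+ 2 | x : F].
have one : (\sum_(y : F) (y == 0%R) = 1)%N.
  by rewrite (bigD1 0) //= eqxx big1 // => y /negPf->.
rewrite -(sum_card_fibres (fun x : F => x ^+ 2)) -[X in (X <= _)%N]addn1.
rewrite -[X in (_ + X <= _)%N]one.
rewrite -big_split /= mulnC -sum_nat_const [X in (_ <= X)%N]big_mkcond /=.
apply: leq_sum => y _.
have [/imsetP[x _ ->]|yS] := ifP; last first.
  have -> : (y == 0) = false.
    apply: contraFF yS => /eqP ->.
    by apply/imsetP; exists 0 => //; rewrite expr0n.
  rewrite eq_card0 // => x; rewrite inE; apply/eqP => xy.
  by rewrite -xy (imset_f (fun x => x ^+ 2)) in yS.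
rewrite sqrf_eq0; have [->|x0] := eqVneq x 0.
  rewrite (@eq_card1 _ 0) // => z.
  by rewrite !inE expr0n /= sqrf_eq0.
rewrite addn0 (@eq_card _ _ (mem [:: x; - x])) => [|z].
  exact: card_size [:: x; - x].
by rewrite !inE eqf_sqr.
Qed.

(** The squares and their reflections [r - y] each fill more than half of the field, so they
    intersect. *)
Lemma sqnorm_surj (F : finFieldType) (r : F) : exists t, sqnorm t = r.
Proof.
pose S := [set x ^+ 2 | x : F]; pose S' := [set r - y | y in S].
have cS' : #|S'| = #|S|.
  by apply: card_imset; apply: inj_comp (addrI r) oppr_inj.
have : ~~ [disjoint S & S'].
  apply/negP => dis; have := card_squares_gt F; rewrite ltnNge => /negP; apply.
  rewrite mul2n -addnn -[in X in (_ + X)%N]cS'.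
  by move: dis; rewrite -leq_card_setU => /eqP <-; apply: max_card.
rewrite disjoint_sym -setI_eq0 => /set0Pn[y /setIP[/imsetP[z /imsetP[v _ ->]]]].
move=> -> /imsetP[u _ e]; exists (u, v).
by rewrite /sqnorm /= -e subrK.
Qed.

(** As for complex numbers, [sqnorm] is multiplicative: multiplication by a [z] of norm [s / r]
    injects one circle into the other. *)
Lemma card_circle_le (F : finFieldType) (r s : F) : r != 0 -> s != 0 ->
  (#|[pred t | sqnorm t == r]| <= #|[pred t | sqnorm t == s]|)%N.
Proof.
move=> r0 s0; have [z zE] := sqnorm_surj (s / r).
pose mulz t := (z.1 * t.1 - z.2 * t.2, z.1 * t.2 + z.2 * t.1).
have sqnormM t : sqnorm (mulz t) = sqnorm z * sqnorm t.
  by rewrite /sqnorm /mulz /=; ring.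
have z0 : sqnorm z != 0 by rewrite zE mulf_neq0 ?invr_eq0.
have inj : injective mulz.
  move=> [t1 t2] [u1 u2] [e1 e2]; congr pair; apply: (mulfI z0).
    (* Multiplying by the conjugate of [z] recovers [sqnorm z] times each coordinate. *)
    transitivity (z.1 * (z.1 * t1 - z.2 * t2) + z.2 * (z.1 * t2 + z.2 * t1)).
      by rewrite /sqnorm; ring.
    by rewrite e1 e2 /sqnorm; ring.
  transitivity (z.1 * (z.1 * t2 + z.2 * t1) - z.2 * (z.1 * t1 - z.2 * t2)).
    by rewrite /sqnorm; ring.
  by rewrite e1 e2 /sqnorm; ring.
rewrite -(card_image inj [pred t | sqnorm t == r]).
apply/subset_leq_card/fintype.subsetP => x /fintype.imageP[t].
by rewrite !inE => /eqP tE ->; rewrite sqnormM tE zE divfK.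
Qed.

Lemma card_hyperbola (R : pzRingType) (F : finFieldType) (r : F) : r != 0 ->
  #|[pred t : F * F | t.1 * t.2 == r]|%:R = #|F|%:R - 1 :> R.
Proof.
move=> r0; rewrite -card_nonzero; congr _%:R.
have inj : injective (fun u : F => (u, r / u)) by move=> u v [].
rewrite -(card_image inj); apply: eq_card => -[u v]; rewrite !inE /=.
apply/eqP/fintype.imageP => [uv|[w w0 [-> ->]]]; last by rewrite mulrC divfK.
have u0 : u != 0 by apply: contra_neq r0 => u0; rewrite -uv u0 mul0r.
by exists u => //; rewrite -uv mulrC mulKf.
Qed.

(** With i a root of -1, x^2 + y^2 = (x + i y) (x - i y); [L] inverts the map (x, y) to (x + i y, x
    - i y). *)
Lemma sqnorm_hyperbolic (F : finFieldType) (i : F) :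
    (2 : F) != 0 -> i ^+ 2 = -1 ->
  exists L : F * F -> F * F, [/\ injective L, {morph L : x y / x + y}
    & forall t, sqnorm (L t) = t.1 * t.2].
Proof.
move=> F2 i2; have i0 : i != 0.
  by apply: contra_eq_neq i2 => ->; rewrite expr0n /= eq_sym oppr_eq0 oner_eq0.
exists (fun t => ((t.1 + t.2) / 2, (t.1 - t.2) / (2 * i))); split.
- move=> [u v] [u' v'] [/(mulIf (invr_neq0 F2)) e1].
  move=> /(mulIf (invr_neq0 (mulf_neq0 F2 i0))) e2.
  congr pair; apply: (mulfI F2).
    transitivity (u + v + (u - v)); first by ring.
    by rewrite e1 e2; ring.
  transitivity (u + v - (u - v)); first by ring.
  by rewrite e1 e2; ring.
- by move=> [u v] [u' v'] /=; congr pair; rewrite /=; field; rewrite ?F2 ?i0.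
- by move=> [u v]; rewrite /sqnorm /=; field: i2; rewrite ?F2 ?i0.
Qed.

Lemma sqnorm_anisotropic (F : finFieldType) :
    (forall i : F, i ^+ 2 != -1) ->
  forall t : F * F, (sqnorm t == 0) = (t == 0).
Proof.
move=> no_i [u v]; apply/eqP/eqP => [|->];
  last by rewrite /sqnorm /= expr0n addr0.
rewrite /sqnorm /= => uv; have v0 : v = 0.
  apply/eqP/negPn/negP => v0; case/eqP: (no_i (u / v)).
  have u2 : u ^+ 2 = - v ^+ 2 by apply/eqP; rewrite -addr_eq0 uv.
  by rewrite expr_div_n u2 mulNr divff ?expf_neq0.
by move: uv; rewrite v0 expr0n addr0 => /eqP; rewrite sqrf_eq0 => /eqP ->.
Qed.

(** By [card_circle_le] in both directions all circles of nonzero radius have one common size; the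
    null circle has one point, so q - 1 times this size is q^2 - 1. *)
Lemma card_circle_anisotropic (R : realFieldType) (F : finFieldType) (r : F) :
    (forall i : F, i ^+ 2 != -1) -> r != 0 ->
  #|[pred t : F * F | sqnorm t == r]|%:R = #|F|%:R + 1 :> R.
Proof.
move=> no_i r0; have sq0 := sqnorm_anisotropic no_i.
have cardr (s : F) : s != 0 ->
    #|[pred t | sqnorm t == s]|%:R = #|[pred t | sqnorm t == r]|%:R :> R.
  by move=> s0; congr _%:R; apply/eqP; rewrite eqn_leq !card_circle_le.
have card0 : #|[pred t : F * F | sqnorm t == 0]| = 1%N.
  by rewrite -(card1 (0 : F * F)); apply: eq_card => t; rewrite !inE sq0.
have e := sum_card_circles cardr; rewrite card0 in e.
have q1 : (#|F|%:R - 1 : R) != 0.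
  by rewrite subr_eq0 (eqr_nat _ _ 1) neq_ltn card_finNzRing_gt1 orbT.
by apply: (mulfI q1); rewrite -subr_sqr expr1n -e addrAC subrr add0r.
Qed.

Lemma card_circle_isotropic (R : pzRingType) (F : finFieldType) (i r : F) :
    (2 : F) != 0 -> i ^+ 2 = -1 -> r != 0 ->
  #|[pred t : F * F | sqnorm t == r]|%:R = #|F|%:R - 1 :> R.
Proof.
move=> F2 i2 r0; have [L [injL LD sqL]] := sqnorm_hyperbolic F2 i2.
rewrite -(card_hyperbola R r0) -(card_image injL [pred t | t.1 * t.2 == r]).
congr _%:R.
apply: eq_card => t; rewrite inE; apply/idP/fintype.imageP => [|[u]].
  move=> tr; exists (invF injL t); last by rewrite f_invF.
  by rewrite inE -sqL f_invF.
by rewrite inE => /eqP ur ->; rewrite sqL ur.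
Qed.

Lemma card_circle (R : realFieldType) (F : finFieldType) : (2 : F) != 0 ->
  exists2 N : R, forall r : F, r != 0 -> #|[pred t | sqnorm t == r]|%:R = N
  & N = #|F|%:R - 1 \/ N = #|F|%:R + 1.
Proof.
move=> F2; have [/existsP[i /eqP i2]|/existsPn no_i] :=
    boolP [exists i : F, i ^+ 2 == -1].
  exists (#|F|%:R - 1); last by left.
  by move=> r; apply: (card_circle_isotropic _ F2 i2).
exists (#|F|%:R + 1); last by right.
by move=> r; apply: card_circle_anisotropic.
Qed.

Lemma energy_sqnorm_le (R : realFieldType) (F : finFieldType)
    (a : F * F -> R) (q := #|F|%:R : R) :
    (2 : F) != 0 -> (forall x, 0 <= a x) ->
  energy (@sqnorm F) a <=
    (q + 1) * (\sum_x a x ^+ 2) ^+ 2 - q * \sum_x a x ^+ 4.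
Proof.
move=> F2 a0; have [/existsP[i /eqP i2]|/existsPn no_i] :=
    boolP [exists i : F, i ^+ 2 == -1].
  have [L [injL LD sqL]] := sqnorm_hyperbolic F2 i2.
  rewrite -(energy_comp _ _ injL LD) [X in X ^+ 2](reindex_inj injL).
  rewrite [X in _ - _ * X](reindex_inj injL).
  have -> : energy (@sqnorm F \o L) (a \o L) =
      energy (fun t => t.1 * t.2) (a \o L).
    apply: eq_bigr => c _; apply: eq_bigr => r _; congr (_ ^+ 2).
    by apply: eq_bigl => t; rewrite /= sqL.
  apply: energy_hyperbolic_le => // [x|r]; [exact: a0|exact: card_hyperbola].
apply: energy_anisotropic_le => // [t|r].
  exact: sqnorm_anisotropic.
exact: card_circle_anisotropic.
Qed.

(** * Moduli, additive characters and Parseval's identity *)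

Lemma normc_ge0 (R : rcfType) (z : R[i]) : 0 <= normc z.
Proof. by case: z => a b; apply: sqrtr_ge0. Qed.

Lemma normc_sum_le (R : rcfType) (I : finType) (P : pred I) (h : I -> R[i]) :
  normc (\sum_(i | P i) h i) <= \sum_(i | P i) normc (h i).
Proof.
apply: (big_ind2 (fun z y => normc z <= y)) => // [|z y z' y' le1 le2].
  by rewrite ComplexField.Normc.normc0.
by apply: le_trans (le_normcD _ _) (lerD le1 le2).
Qed.

Lemma normcX (R : rcfType) (z : R[i]) n : normc (z ^+ n) = normc z ^+ n.
Proof.
elim: n => [|n IHn]; first by rewrite !expr0 ComplexField.Normc.normc1.
by rewrite !exprS ComplexField.Normc.normcM IHn.
Qed.

Lemma dotvDr (F : finFieldType) d (x y z : 'rV[F]_d) :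
  dotv x (y + z) = dotv x y + dotv x z.
Proof. by rewrite -big_split; apply: eq_bigr => i _; rewrite mxE mulrDr. Qed.

Lemma dotvBr (F : finFieldType) d (x y z : 'rV[F]_d) :
  dotv x (y - z) = dotv x y - dotv x z.
Proof. by rewrite -sumrB; apply: eq_bigr => i _; rewrite !mxE mulrBr. Qed.

Lemma dotvDl (F : finFieldType) d (x y z : 'rV[F]_d) :
  dotv (x + y) z = dotv x z + dotv y z.
Proof. by rewrite -big_split; apply: eq_bigr => i _; rewrite mxE mulrDl. Qed.

Lemma dotv0 (F : finFieldType) d (x : 'rV[F]_d) : dotv x 0 = 0.
Proof. by apply: big1 => i _; rewrite mxE mulr0. Qed.

Lemma character0 (R : realType) (F : finFieldType) (e : F -> R[i]) :
  nontrivial_additive_character e -> e 0 = 1.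
Proof.
case=> e1 eD _; have e0 : e 0 != 0.
  apply/eqP => e00; have := e1 0; rewrite e00 ComplexField.Normc.normc0.
  by move/eqP; rewrite eq_sym oner_eq0.
by apply: (mulfI e0); rewrite -eD addr0 mulr1.
Qed.

Lemma character_conj (R : realType) (F : finFieldType) (e : F -> R[i]) x y :
  nontrivial_additive_character e -> e x * (e y)^* = e (x - y).
Proof.
case=> e1 eD _; rewrite -[x in LHS](subrK y) [e (x - y + y)]eD -mulrA -normCK.
by rewrite -[`|e y|]/((normc (e y))%:C%C) e1 expr1n mulr1.
Qed.

Lemma character_orthogonality (R : realType) (F : finFieldType) d
    (e : F -> R[i]) (w : 'rV[F]_d) :
    nontrivial_additive_character e ->
  \sum_x e (dotv x w) = (#|F| ^ d)%:R *+ (w == 0).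
Proof.
move=> he; have [->|w0] := eqVneq w 0.
  under eq_bigr do rewrite dotv0 character0 //.
  by rewrite sumr_const card_mx mul1n.
case: (he) => _ eD [y /eqP ey].
have [i wi] : exists i, w 0 i != 0.
  apply/existsP; rewrite -negb_forall; apply: contra_neqN w0 => /forallP w0.
  by apply/rowP => i; rewrite mxE; apply/eqP; have := w0 i; rewrite ?negbK.
(* Translation by [x0] multiplies the character sum by [e y], which differs from 1, so the sum must
   vanish. *)
pose x0 := (y / w 0 i) *: delta_mx 0 i : 'rV[F]_d.
have x0w : dotv x0 w = y.
  rewrite /dotv (bigD1 i) //= big1 ?addr0 => [|j ji].
    by rewrite !mxE !eqxx mulr1 divfK.
  by rewrite !mxE (negPf ji) andbF mulr0 mul0r.
apply/eqP; rewrite mulr0n; apply: contraNT ey => sum0; apply/eqP.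
apply: (mulIf sum0); rewrite mul1r mulr_sumr.
rewrite [RHS](reindex_inj (addrI x0)); apply: eq_bigr => x _.
by rewrite dotvDl eD x0w.
Qed.

(** Expanding the square as z times its conjugate and summing over [x] first, orthogonality leaves
    only the diagonal, because the frequencies [phi i] are distinct. *)
Lemma parseval (R : realType) (F : finFieldType) d (I : finType)
    (e : F -> R[i]) (phi : I -> 'rV[F]_d) (G : I -> R[i]) :
    nontrivial_additive_character e -> injective phi ->
  \sum_x normc (\sum_i G i * e (dotv x (phi i))) ^+ 2 =
    (#|F| ^ d)%:R * \sum_i normc (G i) ^+ 2.
Proof.
move=> he inj; apply: (@complexI R).
have sqC z : ((normc z ^+ 2)%:C%C) = z * z^* :> R[i].
  by rewrite -normCK -[`|z|]/((normc z)%:C%C) -rmorphXn.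
rewrite rmorphM !rmorph_sum rmorph_nat /=.
under eq_bigr do rewrite sqC rmorph_sum big_distrlr /=.
rewrite exchange_big mulr_sumr /=; apply: eq_bigr => i _.
rewrite exchange_big /=.
transitivity (\sum_j G i * (G j)^* * \sum_x e (dotv x (phi i - phi j))).
  apply: eq_bigr => j _; rewrite mulr_sumr; apply: eq_bigr => x _.
  rewrite rmorphM mulrACA character_conj //; congr (_ * e _).
  by rewrite dotvBr.
rewrite (bigD1 i) //= [X in _ + X]big1 => [|j ji].
  by rewrite addr0 subrr character_orthogonality // eqxx sqC mulrC.
rewrite character_orthogonality // subr_eq0 eq_sym (inj_eq inj) (negPf ji).
by rewrite mulr0.
Qed.

(** * The paraboloid parametrized by the plane, and the extension operator on it *)

Definition space_pt (F : finFieldType) (t : F * F) (s : F) : 'rV[F]_(2 + 1) :=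
  row_mx (\row_j [:: t.1; t.2]`_j) (const_mx s).

Lemma space_ptD (F : finFieldType) (t u : F * F) (r s : F) :
  space_pt t r + space_pt u s = space_pt (t + u) (r + s).
Proof.
rewrite /space_pt add_row_mx; congr row_mx; apply/rowP => j; rewrite !mxE //.
by case: j => [[|[|]]].
Qed.

Lemma space_pt_inj (F : finFieldType) (t u : F * F) (r s : F) :
  space_pt t r = space_pt u s -> t = u /\ r = s.
Proof.
move=> /eq_row_mx[/rowP tu /rowP rs]; split.
  have := tu 0; have := tu 1; rewrite !mxE /=.
  by case: t u {tu} => ? ? [? ?] /= -> ->.
by have := rs 0; rewrite !mxE.
Qed.

Lemma dotv_sqnorm (F : finFieldType) (t : F * F) :
  @dotv F 2 (\row_j [:: t.1; t.2]`_j) (\row_j [:: t.1; t.2]`_j) = sqnorm t.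
Proof. by rewrite /dotv !big_ord_recl big_ord0 !mxE /= addr0 -!expr2. Qed.

Lemma paraboloid_pt_subproof (F : finFieldType) (t : F * F) :
  space_pt t (sqnorm t) \in paraboloid F 2.
Proof. by rewrite inE row_mxKl row_mxKr mxE dotv_sqnorm. Qed.

Definition paraboloid_pt (F : finFieldType) (t : F * F) :
  {xi | xi \in paraboloid F 2} :=
  exist _ (space_pt t (sqnorm t)) (paraboloid_pt_subproof t).

Lemma paraboloid_pt_bij (F : finFieldType) : bijective (@paraboloid_pt F).
Proof.
exists (fun xi => let x : 'rV[F]_(2 + 1) := val xi in
  (x 0 (lshift 1 0), x 0 (lshift 1 1))).
  by move=> [u v]; rewrite /= /space_pt !row_mxEl !mxE.
move=> [x xP]; apply: val_inj => /=; move: xP; rewrite inE => /eqP xP.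
rewrite -[RHS]hsubmxK /space_pt.
have lE : \row_j [:: x 0 (lshift 1 0); x 0 (lshift 1 1)]`_j =
    lsubmx x :> 'rV[F]_2.
  apply/rowP => j; rewrite !mxE; case: j => [[|[|//]]] i; congr (x _ (lshift _ _)).
    exact: val_inj.
  exact: val_inj.
congr row_mx; rewrite /= ?lE //; apply/rowP => j; rewrite (ord1 j) mxE xP -lE.
exact/esym/(dotv_sqnorm (_, _)).
Qed.

Lemma card_paraboloid (F : finFieldType) : #|paraboloid F 2| = (#|F| ^ 2)%N.
Proof.
by rewrite -mulnn -card_prod (bij_eq_card (paraboloid_pt_bij F)) card_sig.
Qed.

Lemma sum_paraboloid (F : finFieldType) (K : nmodType)
    (h : {xi | xi \in paraboloid F 2} -> K) :
  \sum_xi h xi = \sum_t h (paraboloid_pt t).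
Proof. exact: reindex (onW_bij _ (paraboloid_pt_bij F)). Qed.

Lemma sum_extension_pow4 (R : realType) (F : finFieldType) (e : F -> R[i])
    (f : {xi | xi \in paraboloid F 2} -> R[i]) (q := #|F|%:R : R) :
    (2 : F) != 0 -> nontrivial_additive_character e ->
  \sum_x normc (extension e f x) ^+ 4 =
    q ^- 5 * \sum_c \sum_r
      normc (circle_sum (@sqnorm F) (f \o @paraboloid_pt F) c r) ^+ 2.
Proof.
move=> F2 he; case: (he) => _ eD _.
pose G (u : (F * F) * F) := circle_sum (@sqnorm F) (f \o @paraboloid_pt F) u.1 u.2.
(* The sum of the points above [c + t] and [c - t]: by the parallelogram law its height is twice
   [sqnorm c] plus twice [sqnorm t]. *)
pose phi (u : (F * F) * F) :=
  space_pt (u.1 + u.1) (2 * sqnorm u.1 + 2 * u.2).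
have inj : injective phi.
  move=> [c r] [c' r'] /space_pt_inj[/= /(addrr_inj F2) ->].
  by move=> /addrI /(mulfI F2) ->.
have q0 : q != 0 by rewrite pnatr_eq0 -lt0n; apply/card_gt0P; exists 0.
have sqE x : extension e f x ^+ 2 =
    (q%:C%C) ^- 4 * \sum_u G u * e (dotv x (phi u)).
  rewrite /extension card_paraboloid sum_paraboloid exprMn.
  rewrite natrX -exprVn -exprM expr2 exprVn; congr (_ * _).
    by rewrite rmorph_nat.
  rewrite -sum_midpoint // -(pair_bigA _ (fun c r => G (c, r) * e (dotv x (phi (c, r))))) /=.
  apply: eq_bigr => c _; rewrite (partition_big (@sqnorm F) predT) //=.
  apply: eq_bigr => r _; rewrite mulr_suml; apply: eq_bigr => t /eqP tr.
  rewrite mulrACA -eD -dotvDr /= space_ptD; congr (_ * e (dotv x _)).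
  rewrite /phi /= -tr addrACA subrr addr0; congr space_pt.
  by rewrite /sqnorm /=; ring.
have pow4 (z : R[i]) : normc z ^+ 4 = normc (z ^+ 2) ^+ 2.
  by rewrite normcX -exprM.
have normq : normc (q%:C%C ^- 4) = q ^- 4.
  rewrite ComplexField.Normc.normcV normcX /= expr0n addr0 sqrtr_sqr.
  by rewrite ger0_norm.
under eq_bigr do rewrite pow4 sqE ComplexField.Normc.normcM normq exprMn.
rewrite -mulr_sumr parseval // mulrA.
rewrite -(pair_bigA _ (fun c r => normc (G (c, r)) ^+ 2)); congr (_ * _).
(* The normalization contributes q^-8 to the fourth power and Parseval contributes q^3. *)
by rewrite natrX -/q; field.
Qed.

(** * Odd characteristic, powers of the norms and the sharp inequality *)

Lemma two_neq0 (F : finFieldType) : odd #|F| -> (2 : F) != 0.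
Proof.
move=> oddF; apply/eqP => two0.
have : (1 : F) *+ #|F| = 0.
  (* Translation by 1 permutes [F], so it leaves the sum of all elements unchanged. *)
  apply: (addrI (\sum_(x : F) x)).
  by rewrite addr0 -sumr_const -big_split [RHS](reindex_inj (addIr 1)).
rewrite -(odd_double_half #|F|) oddF mulrnDr -mul2n mulrnA two0 mul0rn addr0.
by move/eqP; rewrite oner_eq0.
Qed.

Lemma powR_invK (R : realType) (n : nat) (s : R) :
  (0 < n)%N -> 0 <= s -> (s `^ n%:R^-1) ^+ n = s.
Proof.
move=> n0 s0; rewrite -powR_mulrn ?powR_ge0 // -powRrM mulVf ?powRr1 //.
by rewrite pnatr_eq0 -lt0n.
Qed.

Lemma counting_normX (R : realType) (F : finFieldType) d (n : nat)
    (g : 'rV[F]_d -> R[i]) : (0 < n)%N ->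
  counting_norm n%:R g ^+ n = \sum_x normc (g x) ^+ n.
Proof.
move=> n0; rewrite powR_invK ?sumr_ge0 // => [|x _]; last exact: powR_ge0.
by apply: eq_bigr => x _; rewrite powR_mulrn ?normc_ge0.
Qed.

Lemma surface_normX (R : realType) (F : finFieldType) d (S : {set 'rV[F]_d})
    (n : nat) (f : {xi | xi \in S} -> R[i]) : (0 < n)%N ->
  surface_norm n%:R f ^+ n = (#|S|%:R)^-1 * \sum_xi normc (f xi) ^+ n.
Proof.
move=> n0; rewrite powR_invK // => [|]; last first.
  by rewrite mulr_ge0 ?invr_ge0 // sumr_ge0 // => xi _; apply: powR_ge0.
by congr (_ * _); apply: eq_bigr => xi _; rewrite powR_mulrn ?normc_ge0.
Qed.

Lemma surface_norm_pow4 (R : realType) (F : finFieldType)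
    (f : {xi | xi \in paraboloid F 2} -> R[i]) (q := #|F|%:R : R) :
  surface_norm 2 f ^+ 4 =
    q ^- 4 * (\sum_t normc (f (paraboloid_pt t)) ^+ 2) ^+ 2.
Proof.
rewrite (exprM _ 2 2) surface_normX // card_paraboloid sum_paraboloid exprMn.
by rewrite natrX exprVn -exprM.
Qed.

(** The triangle inequality in each circle sum replaces [f] by its modulus [a], to which the energy
    bound applies. *)
Lemma extension_pow4_le (R : realType) (F : finFieldType) (e : F -> R[i])
    (f : {xi | xi \in paraboloid F 2} -> R[i])
    (a := fun t => normc (f (paraboloid_pt t))) (q := #|F|%:R : R) :
    (2 : F) != 0 -> nontrivial_additive_character e ->
  counting_norm 4 (extension e f) ^+ 4 <=
    q ^- 5 * ((q + 1) * (\sum_t a t ^+ 2) ^+ 2 - q * \sum_t a t ^+ 4).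
Proof.
move=> F2 he; rewrite counting_normX // sum_extension_pow4 //.
apply: ler_wpM2l; first by rewrite invr_ge0 exprn_ge0.
apply: le_trans (energy_sqnorm_le F2 (fun t => normc_ge0 _)).
apply: ler_sum => c _; apply: ler_sum => r _.
rewrite lerXn2r ?nnegrE ?normc_ge0 ?sumr_ge0 // => [t _|].
  by rewrite mulr_ge0 ?normc_ge0.
apply: le_trans (normc_sum_le _ _) _; apply: ler_sum => t _.
by rewrite ComplexField.Normc.normcM.
Qed.

(** Each circle sum is z^2 times the size of the circle; summing squared sizes over the q^2 centres
    gives q^2 (q^3 + q^2 - q), against the factor q^-5. *)
Lemma extension_pow4_const (R : realType) (F : finFieldType) (e : F -> R[i])
    (f : {xi | xi \in paraboloid F 2} -> R[i]) (z : R[i]) (q := #|F|%:R : R) :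
    (2 : F) != 0 -> nontrivial_additive_character e -> (forall xi, f xi = z) ->
  counting_norm 4 (extension e f) ^+ 4 = (1 + q^-1 - q^-2) * normc z ^+ 4.
Proof.
move=> F2 he fz; rewrite counting_normX // sum_extension_pow4 //.
have [N cardN hN] := card_circle R F2.
have csE c r : normc (circle_sum (@sqnorm F) (f \o @paraboloid_pt F) c r) ^+ 2 =
    #|[pred t | @sqnorm F t == r]|%:R ^+ 2 * normc z ^+ 4.
  rewrite /circle_sum (eq_bigr (fun=> z * z)) => [|t _]; last by rewrite /= !fz.
  by rewrite sumr_const normcMn ComplexField.Normc.normcM -mulr_natl; ring.
under eq_bigr => c _ do under eq_bigr do rewrite csE.
under eq_bigr => c _ do rewrite -mulr_suml (sum_sqr_card_circles cardN hN).
have q0 : q != 0 by rewrite pnatr_eq0 -lt0n; apply/card_gt0P; exists 0.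
rewrite sumr_const card_prod -[_ *+ (_ * _)]mulr_natl natrM -/q; field.
by [].
Qed.

Theorem theorem1p1 (R : realType) (p n : nat) (F : finFieldType)
    (e : F -> R[i]) (hp : prime p) (hodd : odd p) (hn : (0 < n)%N)
    (hq : #|F| = (p ^ n)%N) (he : nontrivial_additive_character e) :
  let q : R := #|F|%:R in
  let K : R := 1 + q^-1 - q^-2 in
  let P2 : {set 'rV[F]_(2 + 1)} := paraboloid F 2 in
  [/\ best_extension_constant e P2 2 4 = K `^ 4^-1,
      (forall f : {xi | xi \in P2} -> R[i],
         counting_norm 4 (extension e f) ^+ 4 <= K * surface_norm 2 f ^+ 4),
      (forall C : R,
         (forall f : {xi | xi \in P2} -> R[i],
            counting_norm 4 (extension e f) ^+ 4
              <= C * surface_norm 2 f ^+ 4) ->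
         K <= C),
      (forall f : {xi | xi \in P2} -> R[i],
         (exists c : R[i], forall xi, f xi = c) ->
         counting_norm 4 (extension e f) ^+ 4 = K * surface_norm 2 f ^+ 4)
    & (forall f : {xi | xi \in P2} -> R[i],
         is_maximizer e 2 4 f ->
         exists c : R, forall xi, ComplexField.Normc.normc (f xi) = c)].
Proof.
move=> q K P2.
pose fP2 := {xi | xi \in P2} -> R[i].
have F2 : (2 : F) != 0 by apply: two_neq0; rewrite hq oddX hodd orbT.
have q0 : q != 0 by rewrite pnatr_eq0 -lt0n; apply/card_gt0P; exists 0.
have qgt0 : 0 < q by rewrite lt0r q0 ler0n.
pose mass (f : fP2) r := \sum_t normc (f (paraboloid_pt t)) ^+ r.
(* Regrouping isolates a Cauchy-Schwarz deficit for the squared modulus: its sign gives the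
   inequality and its vanishing the shape of maximizers. *)
have upper (f : fP2) : counting_norm 4 (extension e f) ^+ 4 <=
    K * surface_norm 2 f ^+ 4 - q ^- 6 * (q ^+ 2 * mass f 4%N - mass f 2%N ^+ 2).
  apply: le_trans (extension_pow4_le f F2 he) _; rewrite surface_norm_pow4 -/q.
  rewrite -/(mass f 2%N) -/(mass f 4%N) le_eqVlt; apply/orP; left; apply/eqP.
  by rewrite /K; field.
have variance (f : fP2) : mass f 2%N ^+ 2 <= q ^+ 2 * mass f 4%N.
  have := sqr_sum_le predT (fun t => normc (f (paraboloid_pt t)) ^+ 2).
  by under [X in _ * X]eq_bigr do rewrite -exprM; rewrite card_prod natrM -expr2.
have ineq (f : fP2) : counting_norm 4 (extension e f) ^+ 4 <= K * surface_norm 2 f ^+ 4.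
  apply: le_trans (upper f) _; rewrite lerBlDr lerDl.
  by rewrite mulr_ge0 ?subr_ge0 ?variance // invr_ge0 exprn_ge0 // ltW.
have const (f : fP2) z : (forall xi, f xi = z) ->
    counting_norm 4 (extension e f) ^+ 4 = K * normc z ^+ 4 /\
    surface_norm 2 f ^+ 4 = normc z ^+ 4.
  move=> fz; split; first exact: extension_pow4_const.
  rewrite surface_norm_pow4 -/q; under eq_bigr do rewrite fz.
  by rewrite sumr_const card_prod -[_ *+ (_ * _)]mulr_natl natrM -/q; field.
(* The constant function 1 tests sharpness and also shows that [K] is nonnegative. *)
have [count1 surf1] := const (fun=> 1) 1 (fun=> erefl).
rewrite ComplexField.Normc.normc1 expr1n ?mulr1 in count1 surf1.
have K0 : 0 <= K by rewrite -count1 exprn_ge0 // powR_ge0.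
have K4 : (K `^ 4^-1) ^+ 4 = K by apply: powR_invK.
have inj4 (x y : R) : 0 <= x -> 0 <= y -> x ^+ 4 = y ^+ 4 -> x = y.
  by move=> x0 y0 /eqP; rewrite eqrXn2 // => /eqP.
have best : best_extension_constant e P2 2 4 = K `^ 4^-1.
  apply/eqP; rewrite eq_le; apply/andP.
  have lbK : lbound [set C : R | extension_bound e P2 2 4 C]%classic (K `^ 4^-1).
    move=> C /(_ (fun=> 1)).
    rewrite (inj4 _ 1 _ _ (etrans surf1 (esym (expr1n _ _)))) ?powR_ge0 // mulr1.
    by rewrite (inj4 _ (K `^ 4^-1) _ _ (etrans count1 (esym K4))) ?powR_ge0.
  have inK : [set C : R | extension_bound e P2 2 4 C]%classic (K `^ 4^-1).
    move=> f; rewrite -(@ler_pXn2r _ 4) ?nnegrE ?mulr_ge0 ?powR_ge0 //.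
    by rewrite exprMn K4.
  split; first by apply: ge_inf => //; exists (K `^ 4^-1).
  by apply: lb_le_inf => //; exists (K `^ 4^-1).
split=> // [C leC|f [z fz]|f [_ maxf]].
- by have := leC (fun=> 1); rewrite count1 surf1 mulr1.
- by have [-> ->] := const f z fz.
have max4 : counting_norm 4 (extension e f) ^+ 4 = K * surface_norm 2 f ^+ 4.
  by rewrite maxf best exprMn K4.
(* For a maximizer the deficit in [upper] cannot be positive. *)
have : q ^+ 2 * mass f 4%N <= mass f 2%N ^+ 2.
  have := upper f; rewrite max4 lerBrDr gerDl pmulr_rle0 ?subr_le0 //.
  by rewrite invr_gt0 exprn_gt0.
have -> : mass f 4%N = \sum_t (normc (f (paraboloid_pt t)) ^+ 2) ^+ 2.
  by apply: eq_bigr => t _; rewrite -exprM.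
rewrite expr2 -natrM -card_prod => /sqr_sum_ge_const sq_const.
(* The constant modulus is the root mean square of the modulus of [f]. *)
exists (Num.sqrt (mass f 2%N / #|{: F * F}|%:R)) => xi.
have [pt' _ ptK] := paraboloid_pt_bij F.
rewrite -(ptK xi) /mass -(sq_const (pt' xi)) sqrtr_sqr ger0_norm //.
exact: normc_ge0.
Qed.
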